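(* Let $\mathcal{P}$ be a symmetric property of distributions over $[n]$, let $\epsilon,\delta\in(0,1)$, and let $\mathcal{A}_0(X;r)$ be a $\rho$-replicable algorithm that takes $m$ i.i.d. samples $X=(X_1,\dots,X_m)$ from an unknown distribution $p$ over $[n]$ and internal randomness $r$, outputs a decision in $\{\text{accept},\text{reject}\}$, and satisfies: if $p\in\mathcal{P}$ then $\Pr_{X\sim p^{\otimes m},r}[\mathcal{A}_0(X;r)=\text{accept}]\ge 1-\delta$, and if $p$ is $\epsilon$-far from $\mathcal{P}$ then $\Pr_{X\sim p^{\otimes m},r}[\mathcal{A}_0(X;r)=\text{reject}]\ge 1-\delta$. Then there exists an algorithm $\mathcal{A}'(X;r)$ using $m$ samples that satisfies the same two accuracy guarantees and in addition: (i) it is a canonical random threshold algorithm: there is a deterministic function $h:[n]^m\to[0,1]$ such that, with $r\sim\mathrm{Unif}([0,1])$, $\mathcal{A}'(X;r)$ outputs accept iff $r\le h(X)$; (ii) it is invariant to the order of the samples (for every permutation $\sigma$ of $[m]$, every $r$ and every $X$, $\mathcal{A}'((X_{\sigma(1)},\dots,X_{\sigma(m)});r)=\mathcal{A}'(X;r)$) and to the labels of the samples (for every permutation $\pi$ of $[n]$, every $r$ and every $X$, $\mathcal{A}'((\pi(X_1),\dots,\pi(X_m));r)=\mathcal{A}'(X;r)$); (iii) it is $\rho$-replicable and $\rho$-permutation robust replicable.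
   Context: A property $\mathcal{P}$ is a set of distributions over $[n]$; it is symmetric if for every $p\in\mathcal{P}$ and every permutation $\pi:[n]\to[n]$, $p\circ\pi\in\mathcal{P}$. A distribution $p$ is $\epsilon$-far from $\mathcal{P}$ if its total variation distance to every member of $\mathcal{P}$ is at least $\epsilon$. An algorithm $\mathcal{A}(X;r)$ taking $m$ samples is $\rho$-replicable if for every distribution $\mathcal{D}$ on the sample domain, $\Pr_{X,X'\sim\mathcal{D}^{\otimes m},r}[\mathcal{A}(X;r)=\mathcal{A}(X';r)]\ge 1-\rho$, where $X,X'$ are independent and the same randomness $r$ is used in both runs. For a permutation $\pi$ of $[n]$ and a distribution $p$ on $[n]$, let $p^\pi:=p\circ\pi^{-1}$. An algorithm is $\rho$-permutation robust replicable if for every distribution $p$ over $[n]$ and every permutation $\pi$ of $[n]$, $\Pr_{r\sim\mathrm{Unif}[0,1],X\sim p^{\otimes m},X'\sim(p^\pi)^{\otimes m}}[\mathcal{A}(X;r)\ne\mathcal{A}(X';r)]\le\rho$. *)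

(* Defs.v *)
From HB Require Import structures.
From mathcomp Require Import all_boot all_order all_algebra all_fingroup.
From mathcomp Require Import all_classical all_reals all_analysis.

Set Implicit Arguments.
Unset Strict Implicit.
Unset Printing Implicit Defensive.

Import Order.TTheory GRing.Theory Num.Theory.
Local Open Scope classical_set_scope.
Local Open Scope ring_scope.

Record distr (R : realType) (n : nat) := Distr {
  pmf :> 'I_n -> R;
  pmf_ge0 : forall i, 0 <= pmf i;
  pmf_sum1 : \sum_i pmf i = 1 }.

Section Distributions.
Variables (R : realType) (n : nat).
Implicit Types (p q : distr R n) (s : 'S_n) (P : set (distr R n)).

Lemma distr_comp_sum1 p s : \sum_i p (s i) = 1.
Proof. by rewrite -(pmf_sum1 p) [RHS](reindex_inj (@perm_inj _ s)). Qed.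

Definition distr_comp p s : distr R n :=
  @Distr R n (fun i => p (s i)) (fun i => pmf_ge0 p (s i)) (distr_comp_sum1 p s).

(* p^s = p \o s^-1, the law of s(x) for x drawn from p *)
Definition distr_perm p s : distr R n := distr_comp p (s^-1)%g.

Definition symmetric_property P := forall p s, P p -> P (distr_comp p s).

Definition tv_dist p q : R := 2^-1 * \sum_i `|p i - q i|.

Definition far eps P p := forall q, P q -> eps <= tv_dist p q.

End Distributions.

Notation samples m n := {ffun 'I_m -> 'I_n}.

Notation accept := true (only parsing).
Notation reject := false (only parsing).

(* An algorithm with m samples from [n] and internal randomness in Omega;
   measurability in the randomness makes all the events below measurable. *)
Record algorithm d (Omega : measurableType d) (m n : nat) := Algorithm {
  run :> samples m n -> Omega -> bool;
  run_measurable : forall X, measurable_fun [set: Omega] (run X) }.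

Section Probabilities.
Variables (R : realType) (n m : nat).
Variables (d : measure_display) (Omega : measurableType d).
Variable Q : probability Omega R.
Implicit Types (p q : distr R n) (A : algorithm Omega m n).

Definition iid p (X : samples m n) : R := \prod_i p (X i).

(* Probability of an event under X ~ p^m and r ~ Q independent; since the
   sample space is finite, the product measure is this finite mixture. *)
Definition Pr1 p (E : samples m n -> Omega -> Prop) : R :=
  \sum_X iid p X * fine (Q [set r | E X r]).

(* The same under X ~ p^m, X' ~ q^m and r ~ Q, all independent. *)
Definition Pr2 p q (E : samples m n -> samples m n -> Omega -> Prop) : R :=
  \sum_X \sum_X' iid p X * iid q X' * fine (Q [set r | E X X' r]).

Definition accurate (P : set (distr R n)) (eps delta : R) A :=
  (forall p, P p -> 1 - delta <= Pr1 p (fun X r => A X r = accept)) /\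
  (forall p, far eps P p -> 1 - delta <= Pr1 p (fun X r => A X r = reject)).

Definition replicable (rho : R) A :=
  forall p, 1 - rho <= Pr2 p p (fun X X' r => A X r = A X' r).

Definition perm_robust_replicable (rho : R) A :=
  forall p (s : 'S_n),
    Pr2 p (distr_perm p s) (fun X X' r => A X r <> A X' r) <= rho.

Definition order_invariant A :=
  forall (s : 'S_m) (X : samples m n) r, A [ffun i => X (s i)] r = A X r.

Definition label_invariant A :=
  forall (s : 'S_n) (X : samples m n) r, A [ffun i => s (X i)] r = A X r.

End Probabilities.

(* Unif([0,1]), as a probability measure on R *)
Definition unif01 (R : realType) : probability (measurableTypeR R) R :=
  uniform_prob (@ltr01 R).

Definition canonical_threshold (R : realType) (m n : nat)
    (A : algorithm (measurableTypeR R) m n) :=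
  exists h : samples m n -> R,
    (forall X, 0 <= h X <= 1) /\ (forall X (r : R), A X r = (r <= h X)).

(* Main.v *)
Require Import Defs.
From mathcomp Require Import all_boot all_order all_algebra all_fingroup.
From mathcomp Require Import all_classical all_reals all_analysis.

Set Implicit Arguments.
Unset Strict Implicit.
Unset Printing Implicit Defensive.

Import Order.TTheory GRing.Theory Num.Theory.
Local Open Scope classical_set_scope.
Local Open Scope ring_scope.

(** The new algorithm accepts [X] with probability [h X], the average over all
    relabelings [s] of [n] and reorderings [u] of [m] of the probability that
    [A0] accepts [s o X o u]. Since [s o X o u] is an i.i.d. sample from [p]
    relabeled by [s], each average inherits the accuracy of [A0] by symmetry of
    the property. Two runs of a threshold algorithm disagree with probability
    [|h X - h X'|]; by the triangle inequality this is at most the average of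
    the differences of acceptance probabilities of [A0], each of which is at
    most the probability that [A0] disagrees. Invariance of [h] under
    relabeling turns replicability into permutation robustness. *)

(** * Real-valued probabilities of complements, differences and subsets *)

Lemma fine_probability_setC (R : realType) d (Omega : measurableType d)
    (Q : probability Omega R) (S : set Omega) :
  measurable S -> fine (Q (~` S)) = 1 - fine (Q S).
Proof.
move=> mS; rewrite probability_setC// fineB//.
exact: fin_num_measure.
Qed.

Lemma fine_probability_setD (R : realType) d (Omega : measurableType d)
    (Q : probability Omega R) (S T : set Omega) :
  measurable S -> measurable T -> S `<=` T ->
  fine (Q (T `\` S)) = fine (Q T) - fine (Q S).
Proof.
move=> mS mT ST; rewrite measureD// ?setIidr// ?fineB//.
- exact: fin_num_measure.
- exact: fin_num_measure.
- by rewrite ltey_eq fin_num_measure.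
Qed.

Lemma le_fine_probability (R : realType) d (Omega : measurableType d)
    (Q : probability Omega R) (S T : set Omega) :
  measurable S -> measurable T -> S `<=` T -> fine (Q S) <= fine (Q T).
Proof.
move=> mS mT ST; apply: fine_le; rewrite ?fin_num_measure//.
by apply: le_measure; rewrite ?inE.
Qed.

(** * Acceptance and disagreement probabilities over the internal randomness *)

Section AcceptanceProbability.
Context (R : realType) (n m : nat) (d : measure_display).
Context (Omega : measurableType d) (Q : probability Omega R).
Implicit Types (A : algorithm Omega m n) (p q : distr R n) (X Y : samples m n).

Definition accept_prob A X : R := fine (Q [set r | A X r = accept]).

Lemma measurable_accept A X : measurable [set r | A X r = accept].
Proof.
have := run_measurable A X measurableT (Y := [set true]).
by rewrite setTI; apply.
Qed.

Lemma measurable_disagree A X Y : measurable [set r | A X r <> A Y r].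
Proof.
have -> : [set r | A X r <> A Y r] =
    ([set r | A X r = accept] `\` [set r | A Y r = accept]) `|`
    ([set r | A Y r = accept] `\` [set r | A X r = accept]).
  apply/seteqP; split=> r /=; case: (A X r); case: (A Y r); intuition congruence.
by apply: measurableU; apply: measurableD; apply: measurable_accept.
Qed.

Lemma accept_prob_itv A X : 0 <= accept_prob A X <= 1.
Proof.
rewrite fine_ge0//=.
rewrite -[leRHS](_ : fine (Q setT) = 1); last by rewrite probability_setT.
by apply: le_fine_probability => //; exact: measurable_accept.
Qed.

Lemma reject_probE A X :
  fine (Q [set r | A X r = reject]) = 1 - accept_prob A X.
Proof.
rewrite -fine_probability_setC; last exact: measurable_accept.
congr (fine (Q _)); apply/seteqP; split=> r /=; case: (A X r); intuition congruence.
Qed.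

Lemma agree_probE A X Y :
  fine (Q [set r | A X r = A Y r]) = 1 - fine (Q [set r | A X r <> A Y r]).
Proof.
rewrite -fine_probability_setC; last exact: measurable_disagree.
congr (fine (Q _)); apply/seteqP.
by split=> r /=; case: (A X r); case: (A Y r); intuition congruence.
Qed.

Lemma disagree_probC A X Y :
  fine (Q [set r | A X r <> A Y r]) = fine (Q [set r | A Y r <> A X r]).
Proof.
by congr (fine (Q _)); apply/seteqP; split=> r /= /nesym.
Qed.

(** An outcome that accepts one sample and not the other is a disagreement, which gives each
    one-sided bound; the absolute value follows by exchanging [X] and [Y]. *)
Lemma accept_prob_dist_le A X Y :
  `|accept_prob A X - accept_prob A Y| <= fine (Q [set r | A X r <> A Y r]).
Proof.
have half X' Y' :
    accept_prob A X' - accept_prob A Y' <= fine (Q [set r | A X' r <> A Y' r]).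
  have mX := measurable_accept A X'; have mY := measurable_accept A Y'.
  have mD := measurable_disagree A X' Y'.
  (* With [D] the disagreement event and [S] the acceptance of [Y'], [D] is [S] union [D] minus [S]
     without [D]. The first contains the acceptance of [X'] and the second lies in [S], so the bound
     holds term by term. *)
  have -> : fine (Q [set r | A X' r <> A Y' r]) =
      fine (Q ([set r | A Y' r = accept] `|` [set r | A X' r <> A Y' r])) -
      fine (Q ([set r | A Y' r = accept] `\` [set r | A X' r <> A Y' r])).
    rewrite -fine_probability_setD//; first last.
    - by move=> r /= [yr _]; left.
    - exact: measurableU.
    - exact: measurableD.
    congr (fine (Q _)); apply/seteqP.
    by split=> r /=; case: (A X' r); case: (A Y' r); intuition congruence.
  apply: lerB.
    apply: le_fine_probability => //; first exact: measurableU.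
    by move=> r /=; case: (A X' r); case: (A Y' r); intuition congruence.
  by apply: le_fine_probability => //; exact: measurableD.
by rewrite ler_norml lerNl opprB half andbT disagree_probC half.
Qed.

Lemma iid_ge0 p X : 0 <= iid p X.
Proof. by apply: prodr_ge0 => i _; exact: Defs.pmf_ge0. Qed.

Lemma iid_sum1 p : \sum_(X : samples m n) iid p X = 1.
Proof.
rewrite /iid -(bigA_distr_bigA (fun (_ : 'I_m) j => p j)) big1// => i _.
exact: pmf_sum1.
Qed.

Lemma Pr1_reject A p :
  Pr1 Q p (fun X r => A X r = reject) =
  1 - \sum_X iid p X * accept_prob A X.
Proof.
rewrite -(iid_sum1 p) -sumrB; apply: eq_bigr => X _.
by rewrite reject_probE mulrBr mulr1.
Qed.

Lemma Pr2_agree A p q :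
  Pr2 Q p q (fun X Y r => A X r = A Y r) =
  1 - Pr2 Q p q (fun X Y r => A X r <> A Y r).
Proof.
rewrite -(iid_sum1 p) -sumrB; apply: eq_bigr => X _.
rewrite -[X in X - _]mulr1 -(iid_sum1 q) mulr_sumr -sumrB.
by apply: eq_bigr => Y _; rewrite agree_probE mulrBr mulr1.
Qed.

Lemma replicableE rho A :
  replicable Q rho A <->
  forall p, Pr2 Q p p (fun X Y r => A X r <> A Y r) <= rho.
Proof.
by split=> H p; have := H p; rewrite Pr2_agree lerD2l lerN2.
Qed.

End AcceptanceProbability.

(** * The joint action on labels and positions, and averages over it *)

Section Relabeling.
Context (R : realType) (n m : nat).
Implicit Types (p q : distr R n) (X Y : samples m n).

Definition relabel (t : 'S_n * 'S_m) X : samples m n :=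
  [ffun i => t.1 (X (t.2 i))].

Lemma relabel_inj t : injective (relabel t).
Proof.
move=> X Y /ffunP XY; apply/ffunP => i; have := XY (t.2^-1%g i).
by rewrite !ffunE permKV => /perm_inj.
Qed.

(** Reordering only permutes the factors of the product, and the inverse in [distr_perm] cancels the
    relabeling. *)
Lemma iid_relabel p t X : iid (distr_perm p t.1) (relabel t X) = iid p X.
Proof.
rewrite /iid [RHS](reindex_inj (@perm_inj _ t.2)).
by apply: eq_bigr => i _; rewrite /= ffunE permK.
Qed.

Lemma sum_iid_relabel p t (g : samples m n -> R) :
  \sum_X iid p X * g (relabel t X) = \sum_X iid (distr_perm p t.1) X * g X.
Proof.
rewrite [RHS](reindex_inj (@relabel_inj t)).
by apply: eq_bigr => X _; rewrite iid_relabel.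
Qed.

(** The distance from [distr_perm p s] to [q] equals that from [p] to [distr_comp q s], which is
    again in [P] by symmetry. *)
Lemma far_distr_perm (P : set (distr R n)) eps p s :
  symmetric_property P -> far eps P p -> far eps P (distr_perm p s).
Proof.
move=> symP farp q Pq; have := farp _ (symP q s Pq).
congr (_ <= _ * _); rewrite [RHS](reindex_inj (@perm_inj _ s)).
by apply: eq_bigr => i _; rewrite /= permK.
Qed.

Definition average (f : samples m n -> R) X : R :=
  #|{: 'S_n * 'S_m}|%:R^-1 * \sum_t f (relabel t X).

Lemma mean_const (c : R) : #|{: 'S_n * 'S_m}|%:R^-1 *
  \sum_(t : 'S_n * 'S_m) c = c.
Proof.
rewrite sumr_const -[c *+ _]mulr_natl mulKf// pnatr_eq0 -lt0n.
by apply/card_gt0P; exists (1%g, 1%g).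
Qed.

Lemma mean_le_const (F : 'S_n * 'S_m -> R) c :
  (forall t, F t <= c) -> #|{: 'S_n * 'S_m}|%:R^-1 * \sum_t F t <= c.
Proof.
move=> Fc; rewrite -[leRHS]mean_const ler_wpM2l ?invr_ge0//.
exact: ler_sum.
Qed.

Lemma mean_ge_const (F : 'S_n * 'S_m -> R) c :
  (forall t, c <= F t) -> c <= #|{: 'S_n * 'S_m}|%:R^-1 * \sum_t F t.
Proof.
move=> Fc; rewrite -[leLHS]mean_const ler_wpM2l ?invr_ge0//.
exact: ler_sum.
Qed.

Lemma sum_iid_average p (f : samples m n -> R) :
  \sum_X iid p X * average f X =
  #|{: 'S_n * 'S_m}|%:R^-1 *
    \sum_(t : 'S_n * 'S_m) \sum_X iid (distr_perm p t.1) X * f X.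
Proof.
under [in RHS]eq_bigr do rewrite -sum_iid_relabel.
rewrite exchange_big mulr_sumr; apply: eq_bigr => X _.
by rewrite mulrCA mulr_sumr.
Qed.

Lemma average_order f (u : 'S_m) X :
  average f [ffun i => X (u i)] = average f X.
Proof.
congr (_ * _).
(* Products of permutations apply the left factor first, so [t.2 * u] sends [i] to [u (t.2 i)]. *)
rewrite [RHS](reindex_inj (h := fun t : 'S_n * 'S_m => (t.1, (t.2 * u)%g))).
  apply: eq_bigr => t _; congr f; apply/ffunP => i.
  by rewrite !ffunE permM.
by move=> [t1 t2] [w1 w2] [-> /mulIg ->].
Qed.

Lemma average_label f (s : 'S_n) X :
  average f [ffun i => s (X i)] = average f X.
Proof.
congr (_ * _).
rewrite [RHS](reindex_inj (h := fun t : 'S_n * 'S_m => ((s * t.1)%g, t.2))).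
  apply: eq_bigr => t _; congr f; apply/ffunP => i.
  by rewrite !ffunE permM.
by move=> [t1 t2] [w1 w2] [/mulgI -> ->].
Qed.

Lemma average_dist_le f X Y :
  `|average f X - average f Y| <=
  #|{: 'S_n * 'S_m}|%:R^-1 *
    \sum_(t : 'S_n * 'S_m) `|f (relabel t X) - f (relabel t Y)|.
Proof.
rewrite /average -mulrBr -sumrB normrM ger0_norm ?invr_ge0//.
by rewrite ler_wpM2l ?invr_ge0// ler_norm_sum.
Qed.

(** The same [t] acts on both samples, so for each [t] the pair is again drawn from one common
    distribution, as replicability requires. *)
Lemma sum_iid_average_dist p f :
  \sum_X \sum_Y iid p X * iid p Y * `|average f X - average f Y| <=
  #|{: 'S_n * 'S_m}|%:R^-1 * \sum_(t : 'S_n * 'S_m)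
    \sum_X \sum_Y iid (distr_perm p t.1) X * iid (distr_perm p t.1) Y *
      `|f X - f Y|.
Proof.
have -> : \sum_(t : 'S_n * 'S_m)
      \sum_X \sum_Y iid (distr_perm p t.1) X * iid (distr_perm p t.1) Y *
        `|f X - f Y| =
    \sum_(t : 'S_n * 'S_m) \sum_X \sum_Y
      iid p X * iid p Y * `|f (relabel t X) - f (relabel t Y)|.
  apply: eq_bigr => t _; rewrite [LHS](reindex_inj (@relabel_inj t)).
  apply: eq_bigr => X _; rewrite [LHS](reindex_inj (@relabel_inj t)).
  by apply: eq_bigr => Y _; rewrite !iid_relabel.
rewrite [X in _ * X]exchange_big mulr_sumr; apply: ler_sum => X _.
rewrite [X in _ * X]exchange_big mulr_sumr; apply: ler_sum => Y _.
rewrite -mulr_sumr mulrCA.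
by rewrite ler_wpM2l ?average_dist_le// mulr_ge0 ?iid_ge0.
Qed.

End Relabeling.

(** * Threshold algorithms with a uniform threshold *)

Section Threshold.
Context (R : realType) (n m : nat).
Implicit Types (h : samples m n -> R) (p q : distr R n).

Lemma measurable_threshold (b : R) :
  measurable_fun [set: measurableTypeR R] (fun r : measurableTypeR R => r <= b).
Proof.
by apply: measurable_realfun.measurable_fun_ler;
  [exact: measurable_id|exact: measurable_cst].
Qed.

Definition threshold h : algorithm (measurableTypeR R) m n :=
  @Algorithm _ (measurableTypeR R) m n (fun X r => r <= h X)
    (fun X => measurable_threshold (h X)).

Lemma unif01_le (b : R) : 0 <= b <= 1 ->
  fine (unif01 R [set r : R | (r <= b) = true]) = b.
Proof.
move=> /andP[b0 b1].
rewrite /unif01 /= /uniform_prob integral_uniform_pdf.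
have -> : [set r : R | (r <= b) = true] `&` `[0, 1] = `[0, b]%classic.
  apply/seteqP; split=> r /=; rewrite !in_itv/=.
    by move=> [-> /andP[->]].
  by move=> /andP[-> rb]; split => //; exact: le_trans rb b1.
rewrite (eq_integral (fun=> 1%:E)); last first.
  move=> x; rewrite inE/= in_itv/= => /andP[x0 xb].
  by rewrite /uniform_pdf x0 (le_trans xb b1) subr0 invr1.
rewrite integral_cst//= mul1e lebesgue_measure_itv/= lte_fin.
(* The length formula for intervals branches on [0 < b]; at [b = 0] both sides vanish. *)
by case: ltgtP b0 => //= _ _; rewrite oppr0 addr0.
Qed.

Lemma threshold_accept_prob h X : 0 <= h X <= 1 ->
  accept_prob (unif01 R) (threshold h) X = h X.
Proof. exact: unif01_le. Qed.

(** When [h X <= h Y], the two runs differ exactly for [r] in the half-open interval from [h X]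
    (excluded) to [h Y] (included). *)
Lemma threshold_disagree_prob h X Y :
  (forall Z, 0 <= h Z <= 1) ->
  fine (unif01 R [set r | threshold h X r <> threshold h Y r]) =
  `|h X - h Y|.
Proof.
move=> h01; wlog XY : X Y / h X <= h Y.
  move=> H; case/orP: (le_total (h X) (h Y)) => /H//.
  by rewrite disagree_probC distrC.
rewrite distrC ger0_norm ?subr_ge0// -(threshold_accept_prob (h01 X)).
rewrite -(threshold_accept_prob (h01 Y)) /accept_prob -fine_probability_setD.
- congr (fine (unif01 R _)); apply/seteqP; split=> r /=.
    case: (leP r (h X)) => rX; first by rewrite (le_trans rX XY).
    by case: (r <= h Y).
  by move=> [-> /negP/negbTE ->].
- exact: measurable_accept.
- exact: measurable_accept.
- by move=> r /= rX; exact: le_trans rX XY.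
Qed.

Lemma threshold_Pr2 h p q : (forall Z, 0 <= h Z <= 1) ->
  Pr2 (unif01 R) p q (fun X Y r => threshold h X r <> threshold h Y r) =
  \sum_X \sum_Y iid p X * iid q Y * `|h X - h Y|.
Proof.
move=> h01; apply: eq_bigr => X _; apply: eq_bigr => Y _.
by rewrite threshold_disagree_prob.
Qed.

End Threshold.

Theorem mainTheorem1 (R : realType) (n m : nat) (P : set (distr R n))
    (eps delta rho : R)
    (d : measure_display) (Omega : measurableType d) (Q : probability Omega R)
    (A0 : algorithm Omega m n) :
  symmetric_property P ->
  0 < eps < 1 -> 0 < delta < 1 ->
  replicable Q rho A0 ->
  accurate Q P eps delta A0 ->
  exists A' : algorithm (measurableTypeR R) m n,
    [/\ accurate (unif01 R) P eps delta A',
        canonical_threshold A',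
        order_invariant A' /\ label_invariant A' &
        replicable (unif01 R) rho A' /\
        perm_robust_replicable (unif01 R) rho A'].
Proof.
move=> symP _ _ /replicableE repA0 [accA0 rejA0].
pose f := accept_prob Q A0; pose h := average f.
have h01 X : 0 <= h X <= 1.
  by apply/andP; split; [apply: mean_ge_const|apply: mean_le_const] => t;
    have /andP[] := accept_prob_itv Q A0 (relabel t X).
have acc_sum p : \sum_X iid p X * accept_prob (unif01 R) (threshold h) X =
    \sum_X iid p X * h X.
  by apply: eq_bigr => X _; rewrite threshold_accept_prob.
(* This bound serves both replicability claims: replicability of [A0] is used at every relabeled
   distribution [distr_perm p t.1]. *)
have rep p : \sum_X \sum_Y iid p X * iid p Y * `|h X - h Y| <= rho.
  apply: le_trans (sum_iid_average_dist p f) _.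
  apply: mean_le_const => t; apply: le_trans (repA0 (distr_perm p t.1)).
  apply: ler_sum => X _; apply: ler_sum => Y _.
  by rewrite ler_wpM2l ?accept_prob_dist_le// mulr_ge0 ?iid_ge0.
exists (threshold h); split.
- split=> p Hp.
    rewrite -[leRHS]/(\sum_X iid p X * accept_prob _ _ X) acc_sum.
    rewrite sum_iid_average; apply: mean_ge_const => t.
    (* Each [distr_perm p t.1] lies in [P], being [distr_comp] with the inverse permutation. *)
    exact/accA0/symP.
  rewrite Pr1_reject acc_sum lerD2l lerN2.
  rewrite sum_iid_average; apply: mean_le_const => t.
  by have := rejA0 _ (far_distr_perm t.1 symP Hp); rewrite Pr1_reject lerD2l lerN2.
- by exists h.
- by split=> s X r /=; rewrite /h ?average_order ?average_label.
- split; first by apply/replicableE => p; rewrite threshold_Pr2.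
  move=> p s; rewrite threshold_Pr2//.
  apply: le_trans (rep p); rewrite le_eqVlt; apply/orP; left; apply/eqP.
  apply: eq_bigr => X _.
  (* Writing the second sample as the relabeling by [s] of some [Y] turns its weight into [iid p Y]
     and leaves [h] unchanged, so the sum reduces to the one bounded in [rep]. *)
  rewrite [LHS](reindex_inj (@relabel_inj n m (s, 1%g))).
  apply: eq_bigr => Y _; rewrite (iid_relabel p (s, 1%g)); congr (_ * `|_ - _|).
  rewrite /h -(average_label f s Y); congr average.
  by apply/ffunP => i; rewrite !ffunE perm1.
Qed.
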